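(* Let $p\geq1$ and let $l,y,l',y'\in D(\mathbb{R}^+,\mathbb{R}^d)$ be such that $l_0\leq y_0$ and $l'_0\leq y'_0$. Let $(x,k)=SP_l(y)$ and $(x',k')=SP_{l'}(y')$. Then for any $T\in\mathbb{R}^+$, \[ V_p(x-x')_T\leq (d+1)V_p(y-y')_T+d|y_0-y'_0|+dV_p(l-l')_T+d|l_0-l'_0| \] and \[ V_p(k-k')_T\leq dV_p(y-y')_T+d|y_0-y'_0|+dV_p(l-l')_T+d|l_0-l'_0|. \]
   Context: $\mathbb{R}^+=[0,\infty)$; $D(\mathbb{R}^+,\mathbb{R}^d)$ is the space of càdlàg functions $\mathbb{R}^+\to\mathbb{R}^d$. For such $x$, $v_p(x)_{[a,b]}=\sup\sum_{i=1}^n|x_{t_i}-x_{t_{i-1}}|^p$ over subdivisions $a=t_0<\dots<t_n=b$ ($|\cdot|$ Euclidean norm), $V_p(x)_{[a,b]}=(v_p(x)_{[a,b]})^{1/p}$ and $V_p(x)_T=V_p(x)_{[0,T]}$. For vectors, $u\leq v$ means $u^i\leq v^i$ for all components; for functions, $x\leq x'$ means $x_t\leq x'_t$ for all $t$. Skorokhod problem: given $y,l\in D(\mathbb{R}^+,\mathbb{R}^d)$ with $l_0\leq y_0$, a pair $(x,k)$ of elements of $D(\mathbb{R}^+,\mathbb{R}^d)$ is a solution of the Skorokhod problem associated with $y$ and lower barrier $l$, written $(x,k)=SP_l(y)$, if (i) $x_t=y_t+k_t\geq l_t$ for all $t\in\mathbb{R}^+$; (ii) $k_0=0$, each component $k^i$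 is nondecreasing and $\int_0^t(x^i_s-l^i_s)\,dk^i_s=0$ for all $t$ and $i=1,\dots,d$. *)

(* Defs.v *)
From HB Require Import structures.
From mathcomp Require Import all_boot all_order all_algebra.
From mathcomp Require Import all_classical all_reals all_analysis.
Set Implicit Arguments. Unset Strict Implicit. Unset Printing Implicit Defensive.
Import Order.TTheory GRing.Theory Num.Theory.
Import numFieldNormedType.Exports.
Local Open Scope classical_set_scope.
Local Open Scope ring_scope.

Definition eucl {R : realType} {d : nat} (v : 'rV[R]_d) : R :=
  Num.sqrt (\sum_(i < d) (v ord0 i) ^+ 2).

Definition vle {R : realType} {d : nat} (u v : 'rV[R]_d) : Prop :=
  forall i : 'I_d, u ord0 i <= v ord0 i.

Definition cadlag {R : realType} {d : nat} (x : R -> 'rV[R]_d) : Prop :=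
  (forall t : R, 0 <= t -> x @ at_right t --> x t) /\
  (forall t : R, 0 < t -> cvg (x @ at_left t)).

Definition subdivision {R : realType} (a b : R) (n : nat) (t : nat -> R) : Prop :=
  t 0%N = a /\ t n = b /\ (forall i : nat, (i < n)%N -> t i < t i.+1).

Definition pvar {R : realType} {d : nat} (p : R) (x : R -> 'rV[R]_d) (a b : R)
  : \bar R :=
  ereal_sup [set r : \bar R | exists (n : nat) (t : nat -> R),
      subdivision a b n t /\
      r = ((\sum_(i < n) (eucl (x (t i.+1) - x (t i))) `^ p)%:E)%E].

Definition Vp {R : realType} {d : nat} (p : R) (x : R -> 'rV[R]_d) (T : R)
  : \bar R :=
  poweR (pvar p x 0 T) (p^-1).

(* (x,k) = SP_l(y): solution of the Skorokhod problem with lower barrier l.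
   The Stieltjes integral int_0^t (x^i_s - l^i_s) dk^i_s is taken against the
   Lebesgue-Stieltjes measure of the nondecreasing right-continuous function
   equal to k^i on [0,oo) and to 0 on (-oo,0) (so that k^i_0 = 0 carries no
   mass at 0). *)
Definition SP {R : realType} {d : nat} (l y x k : R -> 'rV[R]_d) : Prop :=
  cadlag x /\ cadlag k /\
  (forall t : R, 0 <= t -> x t = y t + k t /\ vle (l t) (x t)) /\
  k 0 = 0 /\
  (forall i : 'I_d, forall s t : R, 0 <= s -> s <= t -> k s ord0 i <= k t ord0 i) /\
  (forall i : 'I_d, exists F : cumulative R R,
      (forall s : R, 0 <= s -> F s = k s ord0 i) /\
      (forall s : R, s < 0 -> F s = 0) /\
      (forall t : R, 0 <= t ->
         (\int[lebesgue_stieltjes_measure F]_(s in `[0%R, t]%classic)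
             ((x s ord0 i - l s ord0 i)%:E))%E = 0%E)).

(* Main.v *)
(** In each coordinate, put f = k - k' and g = (l - y) - (l' - y').  If f
    increases from s to t, then so does k, so the barrier l is hit at some u in
    (s, t] with k u close to k t; since k' t >= k' u >= l' u - y' u, this gives
    f t <= g u + e.  Symmetrically f t >= g u - e for some such u if f
    decreases.  As p >= 1, merging consecutive increments of f of the same sign
    only increases the sum of their p-th powers; once the increments alternate,
    the increments of g between the hitting times dominate those of f up to
    2 e, except that f starts from f 0 = 0 instead of g 0.  Hence
    V_p(f) <= V_p(g) + |g 0|, and the bounds follow from Minkowski's
    inequality. *)

Require Import Defs.
From HB Require Import structures.
From mathcomp Require Import all_boot all_order all_algebra.
From mathcomp Require Import all_classical all_reals all_analysis.
From mathcomp Require Import measurable_realfun ring lra zify.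
Set Implicit Arguments.
Unset Strict Implicit.
Unset Printing Implicit Defensive.
Import Order.TTheory GRing.Theory Num.Theory.
Import numFieldNormedType.Exports.
Local Open Scope ring_scope.
Local Open Scope classical_set_scope.

Lemma ge0_lee_poweR {R : realType} (x y : \bar R) (r : R) :
  0 <= r -> (0 <= x)%E -> (x <= y)%E -> (poweR x r <= poweR y r)%E.
Proof.
move=> r0 x0 xy; apply: gt0_ler_poweR => //; rewrite in_itv/= leey.
  by rewrite x0.
by rewrite (le_trans x0).
Qed.

Section lp_theory.
Context {R : realType}.
Implicit Types p : R.

Definition lp p {n} (a : 'I_n -> R) : R := (\sum_(i < n) `|a i| `^ p) `^ p^-1.

Lemma lp_ge0 p n (a : 'I_n -> R) : 0 <= lp p a.
Proof. exact: powR_ge0. Qed.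

Lemma sum_powR_ge0 p n (a : 'I_n -> R) : 0 <= \sum_(i < n) `|a i| `^ p.
Proof. by apply: sumr_ge0 => i _; exact: powR_ge0. Qed.

Lemma lp_powR p n (a : 'I_n -> R) : p != 0 ->
  lp p a `^ p = \sum_(i < n) `|a i| `^ p.
Proof.
by move=> p0; rewrite /lp -powRrM mulVf// powRr1// sum_powR_ge0.
Qed.

Lemma ler_lp_sum p m n (a : 'I_m -> R) (b : 'I_n -> R) : 0 <= p ->
  \sum_(i < m) `|a i| `^ p <= \sum_(i < n) `|b i| `^ p -> lp p a <= lp p b.
Proof.
by move=> p0 ab; apply: ge0_ler_powR; rewrite ?nnegrE ?invr_ge0 ?sum_powR_ge0.
Qed.

Lemma ler_lp p n (a b : 'I_n -> R) : 0 <= p ->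
  (forall i, `|a i| <= `|b i|) -> lp p a <= lp p b.
Proof.
move=> p0 ab; apply: ler_lp_sum => //; apply: ler_sum => i _.
exact: ge0_ler_powR.
Qed.

Lemma lp_ord1 p (c : R) : p != 0 -> lp p (fun _ : 'I_1 => c) = `|c|.
Proof. by move=> p0; rewrite /lp big_ord1 -powRrM mulfV// powRr1. Qed.

Lemma norm_le_lp p n (a : 'I_n -> R) i : 0 < p -> `|a i| <= lp p a.
Proof.
move=> p0; rewrite -(@lp_ord1 p) ?gt_eqF//; apply: ler_lp_sum; first exact: ltW.
rewrite big_ord1 (bigD1 i)//= lerDl.
by apply: sumr_ge0 => j _; exact: powR_ge0.
Qed.

Lemma ler_lpD p n (a b : 'I_n -> R) : 1 <= p ->
  lp p (a \+ b) <= lp p a + lp p b.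
Proof.
move=> p1; have p0 : p != 0 by rewrite gt_eqF// (lt_le_trans _ p1).
pose mu : {measure set nat -> \bar R} := msum (fun i => \d_i) n.
pose extend (c : 'I_n -> R) k := oapp c 0 (insub k).
have lpE c : ('N[mu]_p%:E [EFin \o extend c])%E = (lp p c)%:E.
  rewrite unlock ge0_integral_measure_sum//; last first.
    by move=> k _; exact: poweR_ge0.
  rewrite -poweR_EFin -sumEFin; congr (_ `^ _)%E; apply: eq_bigr => i _.
  by rewrite integral_dirac// diracE in_setT mul1e /extend /= valK.
have extendD : extend (a \+ b) = (extend a \+ extend b)%R.
  by apply/funext => k; rewrite /extend /=; case: insub => //=; rewrite addr0.
have := @minkowski_EFin _ _ _ mu (extend a) (extend b) p.
by rewrite -extendD !lpE lee_fin; apply.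
Qed.

Lemma lp_normr p n (a : 'I_n -> R) : lp p (fun i => `|a i|) = lp p a.
Proof. by rewrite /lp; under eq_bigr do rewrite normr_id. Qed.

Lemma lp0 p n : p != 0 -> lp p (0 : 'I_n -> R) = 0.
Proof.
move=> p0; rewrite /lp big1 ?powR0 ?invr_eq0// => i _.
by rewrite normr0 powR0.
Qed.

Lemma ler_lp_bigsum p n (I : Type) (r : seq I) (a : I -> 'I_n -> R) : 1 <= p ->
  lp p (\sum_(j <- r) a j) <= \sum_(j <- r) lp p (a j).
Proof.
move=> p1; have p0 : p != 0 by rewrite gt_eqF// (lt_le_trans _ p1).
apply: (big_ind2 (fun f s => lp p f <= s)) => //; first by rewrite lp0.
by move=> f s g t fs gt; rewrite (le_trans (ler_lpD _ _ p1))// lerD.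
Qed.

Lemma powR_superadditive p (x y : R) : 1 <= p -> 0 <= x -> 0 <= y ->
  x `^ p + y `^ p <= (x + y) `^ p.
Proof.
move=> p1 x0 y0; have p0 : 0 < p by exact: lt_le_trans p1.
rewrite -(mulr_powRB1 x0 p0) -(mulr_powRB1 y0 p0).
rewrite -(mulr_powRB1 (addr_ge0 x0 y0) p0) mulrDl.
have pB1 : 0 <= p - 1 by rewrite subr_ge0.
by apply: lerD; apply: ler_wpM2l => //; apply: ge0_ler_powR => //;
  rewrite ?nnegrE ?addr_ge0// ?lerDl ?lerDr.
Qed.

Lemma sum_powR_le p n (a : 'I_n -> R) : 1 <= p ->
  \sum_(i < n) `|a i| `^ p <= (\sum_(i < n) `|a i|) `^ p.
Proof.
move=> p1; have [] // : 0 <= \sum_(i < n) `|a i| /\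
  \sum_(i < n) `|a i| `^ p <= (\sum_(i < n) `|a i|) `^ p.
apply: (big_ind2 (fun s q => 0 <= s /\ q <= s `^ p)) => //.
move=> s q s' q' [s_ge0 qs] [s'_ge0 qs']; split; first exact: addr_ge0.
by rewrite (le_trans _ (powR_superadditive p1 _ _))// lerD.
Qed.

Lemma lp_le_sum p n (a : 'I_n -> R) : 1 <= p -> lp p a <= \sum_(i < n) `|a i|.
Proof.
move=> p1; have p0 : 0 < p by exact: lt_le_trans p1.
have sum_ge0 : 0 <= \sum_(i < n) `|a i| by exact: sumr_ge0.
rewrite -(ger0_norm sum_ge0) -(@lp_ord1 p) ?gt_eqF//.
apply: ler_lp_sum; first exact: ltW.
by rewrite big_ord1 ger0_norm// sum_powR_le.
Qed.

Lemma lp_cst_head_le p n (a b : R) : 1 <= p -> 0 <= a -> 0 <= b ->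
  lp p (fun i : 'I_n => a + (if i == 0%N :> nat then b else 0)) <= a * n%:R + b.
Proof.
move=> p1 a0 b0; pose c (i : 'I_n) := a + (if i == 0%N :> nat then b else 0).
have c_ge0 i : 0 <= c i.
  by rewrite /c; case: ifP => _; rewrite ?addr0// addr_ge0.
apply: le_trans (lp_le_sum c p1) _; under eq_bigr do rewrite ger0_norm//.
rewrite big_split/= sumr_const card_ord -(mulr_natr a); apply: lerD => //.
by case: (n) => [|k]; rewrite ?big_ord0// big_ord_recl big1 ?addr0.
Qed.

End lp_theory.

Section eucl_theory.
Context {R : realType} {d : nat}.
Implicit Types u v : 'rV[R]_d.

Lemma euclE v : eucl v = lp 2 (v ord0).
Proof.
rewrite /lp powR12_sqrt; last exact: sum_powR_ge0.
congr Num.sqrt; apply: eq_bigr => i _.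
by rewrite powR_mulrn// real_normK ?num_real.
Qed.

Lemma eucl_ge0 v : 0 <= eucl v.
Proof. exact: sqrtr_ge0. Qed.

Lemma eucl_const_mx (c : R) : eucl (const_mx c : 'rV_1) = `|c|.
Proof. by rewrite /eucl big_ord1 mxE sqrtr_sqr. Qed.

Lemma norm_coord_le_eucl v i : `|v ord0 i| <= eucl v.
Proof. by rewrite euclE norm_le_lp. Qed.

Lemma eucl_le_sum_norm v : eucl v <= \sum_(i < d) `|v ord0 i|.
Proof. by rewrite euclE lp_le_sum// ler1n. Qed.

Lemma ler_euclD u v : eucl (u + v) <= eucl u + eucl v.
Proof.
rewrite !euclE (_ : (u + v) ord0 = u ord0 \+ v ord0).
  by apply: ler_lpD; rewrite ler1n.
by apply/funext => i; rewrite mxE.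
Qed.

Lemma euclN v : eucl (- v) = eucl v.
Proof. by rewrite /eucl; under eq_bigr do rewrite mxE sqrrN. Qed.

End eucl_theory.

Section subdivision_theory.
Context {R : realType}.
Implicit Types (a b : R) (t : nat -> R).

Lemma subdivision_exists a b : a <= b -> exists n t, subdivision a b n t.
Proof.
rewrite le_eqVlt => /predU1P[<-|ab]; first by exists 0%N, (fun=> a).
by exists 1%N, (fun i => if i is 0 then a else b); split=> //; split=> // -[].
Qed.

Lemma subdivision_ltn a b n t i j : subdivision a b n t ->
  (i < j <= n)%N -> t i < t j.
Proof.
move=> [_ [_ t_lt]] /andP[ij jn].
pose D : {pred nat} := [pred k | (k <= n)%N].
suff : {in D &, {homo t : i j / (i < j)%N >-> i < j}}.
  by apply=> //; rewrite inE; apply/leq_trans/jn/ltnW.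
apply: homo_ltn_in => [y x z|k m _ mn l /andP[_ lm]|k _].
- exact: lt_trans.
- by rewrite inE (leq_trans (ltnW lm)).
- exact: t_lt.
Qed.

Lemma subdivision_ge a b n t i : subdivision a b n t -> (i <= n)%N -> a <= t i.
Proof.
move=> tP; case: i => [_|i i_n]; first by case: tP => ->.
by case: (tP) => <- _; rewrite ltW// (subdivision_ltn tP).
Qed.

Lemma subdivision_bump a b n t i : (i < n)%N ->
  subdivision a b n.+1 t -> subdivision a b n (t \o bump i.+1).
Proof.
move=> i_n tP; case: (tP) => t0 [tn _]; split; last split.
- by rewrite /= /bump.
- by rewrite /= /bump i_n.
- by move=> j j_n; apply: (subdivision_ltn tP); rewrite /bump; lia.
Qed.

End subdivision_theory.

Section lebesgue_stieltjes_itv.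
Context {R : realType} (F : cumulative R R).
Local Notation mu := (lebesgue_stieltjes_measure F).

Lemma lebesgue_stieltjes_itvoc (a b : R) : a <= b ->
  mu `]a, b] = (F b - F a)%:E.
Proof.
move=> ab; rewrite /lebesgue_stieltjes_measure/= /measure_extension/=.
by rewrite measurable_mu_extE/= ?wlength_itv_bnd//; exact: is_ocitv.
Qed.

Lemma lebesgue_stieltjes_set1_ge (c r : R) : (forall u, u < r -> F u <= c) ->
  ((F r - c)%:E <= mu [set r])%E.
Proof.
move=> Fc; pose E n : set R := `]r - n.+1%:R^-1, r].
have muE n : mu (E n) = (F r - F (r - n.+1%:R^-1))%:E.
  by rewrite lebesgue_stieltjes_itvoc// lerBlDr lerDl.
have muE0 : (mu (E 0%N) < +oo)%E by rewrite muE ltry.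
have mE : mu \o E @ \oo --> mu (\bigcap_n E n).
  apply: nonincreasing_cvg_mu => [|n||m n mn].
  - exact: muE0.
  - exact: measurable_itv.
  - by rewrite -set1_bigcap_oc; exact: measurable_set1.
  - apply/subsetPset/subset_itvr; rewrite bnd_simp lerD2l lerN2.
    by rewrite lef_pV2 ?posrE// ler_nat.
rewrite set1_bigcap_oc -(cvg_lim _ mE)//; apply: lime_ge.
  by apply/cvg_ex; eexists; exact: mE.
apply: nearW => n; rewrite /= muE lee_fin lerD2l lerN2 Fc//.
by rewrite ltrBlDr ltrDl.
Qed.

Lemma lebesgue_stieltjes_itvcc_ge (c r v : R) : r <= v ->
  (forall u, u < r -> F u <= c) -> ((F v - c)%:E <= mu `[r, v])%E.
Proof.
move=> rv Fc; rewrite -(setU1itv false) ?bnd_simp//.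
rewrite measureU//=; last first.
  by apply/seteqP; split => // u /= [->]; rewrite in_itv/= ltxx.
rewrite lebesgue_stieltjes_itvoc//.
by rewrite -(subrKA (F r)) addrC EFinD leeD// lebesgue_stieltjes_set1_ge.
Qed.

End lebesgue_stieltjes_itv.

Section integral_lower_bound.
Local Open Scope ereal_scope.
Import HBNNSimple.

Lemma mule_measure_le_integral d (T : measurableType d) (R : realType)
    (mu : {measure set T -> \bar R}) (D A : set T) (f : T -> \bar R) (c : R) :
  (0 <= c)%R -> measurable A -> A `<=` D -> (forall x, D x -> 0 <= f x) ->
  (forall x, A x -> c%:E <= f x) -> c%:E * mu A <= \int[mu]_(x in D) f x.
Proof.
move=> c0 mA AD f0 cf; rewrite ge0_integralE//.
apply: ereal_sup_ubound; exists (scale_nnsfun (indic_nnsfun R mA) c0).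
  move=> x /=; rewrite mindicE /patch.
  have [/set_mem Ax|_] := boolP (x \in A); rewrite ?mulr1 ?mulr0.
    by rewrite mem_set ?cf//; exact: AD.
  by case: ifP => // /set_mem /f0.
by rewrite /= sintegralrM sintegral_indic.
Qed.

End integral_lower_bound.

Section variation_theory.
Context {R : realType} {d : nat}.
Implicit Types (p T : R) (x y : R -> 'rV[R]_d) (t : nat -> R).

Definition lp_incr p x n t : R :=
  lp p (fun i : 'I_n => eucl (x (t i.+1) - x (t i))).

Lemma lp_incr_powR p x n t : p != 0 ->
  lp_incr p x n t `^ p = \sum_(i < n) eucl (x (t i.+1) - x (t i)) `^ p.
Proof.
by move=> p0; rewrite lp_powR//; under eq_bigr do rewrite ger0_norm ?eucl_ge0//.
Qed.

Lemma le_pvar p x a b c : b <= c -> (pvar p x a b <= pvar p x a c)%E.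
Proof.
rewrite le_eqVlt => /predU1P[->//|bc].
apply: ge_ereal_sup => _ [n [t [[ta [tb t_lt]] ->]]].
pose s i := if (i <= n)%N then t i else c.
have st i : (i <= n)%N -> s i = t i by rewrite /s => ->.
have sc : s n.+1 = c by rewrite /s ltnn.
apply: (@le_trans _ _ (\sum_(i < n.+1) eucl (x (s i.+1) - x (s i)) `^ p)%:E).
  rewrite lee_fin big_ord_recr/= -[leLHS]addr0.
  apply: lerD; last exact: powR_ge0.
  by apply: ler_sum => i _; rewrite !st// ltnW.
apply: ereal_sup_ubound; exists n.+1, s; split=> //; split; first by rewrite st.
split=> // i; rewrite ltnS leq_eqVlt => /predU1P[->|i_n]; last first.
  by rewrite !st ?t_lt// ltnW.
by rewrite sc st// tb.
Qed.

Lemma lp_incr_le_Vp p T x n t a : 0 < p -> subdivision 0 a n t -> a <= T ->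
  ((lp_incr p x n t)%:E <= Vp p x T)%E.
Proof.
move=> p0 tP aT; have p_neq0 : p != 0 by rewrite gt_eqF.
have -> : lp_incr p x n t = (lp_incr p x n t `^ p) `^ p^-1.
  by rewrite -powRrM mulfV// powRr1// lp_ge0.
rewrite -poweR_EFin.
apply: ge0_lee_poweR; rewrite ?lee_fin ?powR_ge0 ?invr_ge0 ?(ltW p0)//.
apply: le_trans (le_pvar p x 0 aT); apply: ereal_sup_ubound; exists n, t.
by rewrite lp_incr_powR.
Qed.

Lemma Vp_le p T x (C : \bar R) : 0 < p -> 0 <= T ->
  (forall n t, subdivision 0 T n t -> ((lp_incr p x n t)%:E <= C)%E) ->
  (Vp p x T <= C)%E.
Proof.
move=> p0 T0 lpC; have p_neq0 : p != 0 by rewrite gt_eqF.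
have [n0 [t0 t0P]] := subdivision_exists T0.
have C0 : (0 <= C)%E by apply: le_trans (lpC _ _ t0P); rewrite lee_fin lp_ge0.
have -> : C = poweR (poweR C p) p^-1 by rewrite -poweRrM mulfV// poweRe1.
apply: ge0_lee_poweR; first by rewrite invr_ge0 ltW.
  apply: (@le_trans _ _ (lp_incr p x n0 t0 `^ p)%:E).
    by rewrite lee_fin powR_ge0.
  by apply: ereal_sup_ubound; exists n0, t0; rewrite lp_incr_powR.
apply: ge_ereal_sup => _ [n [t [tP ->]]].
rewrite -(lp_incr_powR x n t p_neq0) -poweR_EFin.
by apply: ge0_lee_poweR; rewrite ?lee_fin ?lp_ge0 ?(ltW p0)// lpC.
Qed.

Lemma lp_incrD p x y n t : 1 <= p ->
  lp_incr p (x \+ y) n t <= lp_incr p x n t + lp_incr p y n t.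
Proof.
move=> p1; apply: le_trans (ler_lpD _ _ p1); apply: ler_lp => [|i].
  exact: le_trans p1.
rewrite !ger0_norm ?addr_ge0 ?eucl_ge0// opprD addrACA; exact: ler_euclD.
Qed.

Lemma VpD p T x y : 1 <= p -> 0 <= T ->
  (Vp p (x \+ y)%R T <= Vp p x T + Vp p y T)%E.
Proof.
move=> p1 T0; have p0 : 0 < p by exact: lt_le_trans p1.
apply: Vp_le => // n t tP.
apply: (@le_trans _ _ (lp_incr p x n t + lp_incr p y n t)%:E).
  by rewrite lee_fin lp_incrD.
by rewrite EFinD leeD// (lp_incr_le_Vp _ p0 tP).
Qed.

End variation_theory.

Lemma le_Vp {R : realType} (m n : nat) (p T : R)
    (x : R -> 'rV[R]_m) (y : R -> 'rV[R]_n) : 0 < p -> 0 <= T ->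
  (forall s t : R, 0 <= s -> 0 <= t -> eucl (x t - x s) <= eucl (y t - y s)) ->
  (Vp p x T <= Vp p y T)%E.
Proof.
move=> p0 T0 xy; apply: Vp_le => // k t tP.
apply: le_trans (lp_incr_le_Vp y p0 tP (lexx T)).
rewrite lee_fin; apply: ler_lp => [|i]; first exact: ltW.
rewrite !ger0_norm ?eucl_ge0//.
by apply: xy; apply: (subdivision_ge tP) => //; exact: ltnW.
Qed.

Lemma VpN {R : realType} (d : nat) (p T : R) (x : R -> 'rV[R]_d) :
  0 < p -> 0 <= T -> Vp p (fun t : R => - x t) T = Vp p x T.
Proof.
move=> p0 T0; apply/eqP; rewrite eq_le.
by apply/andP; split; apply: le_Vp => // s t _ _; rewrite -opprD euclN.
Qed.

Definition real_Vp {R : realType} (p : R) (f : R -> R) (T : R) : \bar R :=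
  Vp p (fun t => const_mx (f t) : 'rV_1) T.

Section real_variation.
Context {R : realType}.
Implicit Types (p T : R) (f : R -> R) (t : nat -> R).

Lemma lp_incr_const_mx p f n t :
  lp_incr p (fun s => const_mx (f s) : 'rV_1) n t =
  lp p (fun i : 'I_n => f (t i.+1) - f (t i)).
Proof.
rewrite -[RHS]lp_normr; congr lp; apply/funext => i.
by rewrite -raddfB eucl_const_mx.
Qed.

Lemma Vp_le_sum_real_Vp d p T (x : R -> 'rV[R]_d) : 1 <= p -> 0 <= T ->
  (Vp p x T <= \sum_(j < d) real_Vp p (fun s : R => x s ord0 j) T)%E.
Proof.
move=> p1 T0; have p0 : 0 < p by exact: lt_le_trans p1.
apply: Vp_le => // n t tP.
pose dx (j : 'I_d) (i : 'I_n) := x (t i.+1) ord0 j - x (t i) ord0 j.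
apply: (@le_trans _ _ (\sum_(j < d) lp p (dx j))%:E).
  rewrite lee_fin -(eq_bigr _ (fun j _ => lp_normr p (dx j))).
  apply: le_trans (ler_lp_bigsum _ _ p1).
  apply: ler_lp => [|i]; first exact: ltW.
  rewrite fct_sumE !ger0_norm ?eucl_ge0//; last first.
    by apply: sumr_ge0 => j _; exact: normr_ge0.
  rewrite (le_trans (eucl_le_sum_norm _))//.
  by apply: ler_sum => j _; rewrite !mxE.
rewrite -sumEFin; apply: lee_sum => j _.
rewrite -[dx j]/(fun i => _) -(lp_incr_const_mx p (fun s => x s ord0 j)).
exact: (lp_incr_le_Vp _ p0 tP).
Qed.

Lemma real_Vp_coord_le d p T (x : R -> 'rV[R]_d) j : 0 < p -> 0 <= T ->
  (real_Vp p (fun s : R => x s ord0 j) T <= Vp p x T)%E.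
Proof.
move=> p0 T0; apply: le_Vp => // s t _ _; rewrite -raddfB eucl_const_mx.
by have := norm_coord_le_eucl (x t - x s) j; rewrite !mxE.
Qed.

End real_variation.

Section alternating_increments.
Context {R : realType}.
Implicit Types (p a b : R) (f g : R -> R) (t : nat -> R).

Definition alternates f n t := forall i, (i.+1 < n)%N ->
  (f (t i.+1) - f (t i)) * (f (t i.+2) - f (t i.+1)) < 0.

Lemma norm_powR_superadditive p (x y : R) : 1 <= p -> 0 <= x * y ->
  `|x| `^ p + `|y| `^ p <= `|x + y| `^ p.
Proof.
move=> p1 xy0; have -> : `|x + y| = `|x| + `|y|; last exact: powR_superadditive.
by case: (ger0P x) xy0; case: (ger0P y); case: (ger0P (x + y)); nra.
Qed.

Lemma sum_incr_bump_le p f n t i : 1 <= p -> (i < n)%N ->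
  0 <= (f (t i.+1) - f (t i)) * (f (t i.+2) - f (t i.+1)) ->
  \sum_(j < n.+1) `|f (t j.+1) - f (t j)| `^ p <=
  \sum_(j < n) `|f (t (bump i.+1 j.+1)) - f (t (bump i.+1 j))| `^ p.
Proof.
move=> p1 i_n same_sign; have i1_n : (i.+1 < n.+1)%N by [].
rewrite (bigD1_ord (Ordinal i1_n))//= (bigD1 (Ordinal i_n))//=.
rewrite [leRHS](bigD1 (Ordinal i_n))//= addrA.
have bumpi : bump i.+1 i = i by rewrite /bump ltnn.
have bumpSi : bump i.+1 i.+1 = i.+2 by rewrite /bump leqnn.
rewrite bumpi bumpSi; apply: lerD; last first.
  apply: ler_sum => j /eqP ji.
  suff -> : bump i.+1 j.+1 = (bump i.+1 j).+1 by [].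
  have {}ji : nat_of_ord j <> i by move=> ji'; apply/ji/val_inj.
  by rewrite /bump; lia.
rewrite addrC (le_trans (norm_powR_superadditive _ _))//.
by rewrite addrC subrKA.
Qed.

Lemma alternating_subdivision p f a b n t : 1 <= p -> subdivision a b n t ->
  exists m s, [/\ (m <= n)%N, subdivision a b m s, alternates f m s &
    \sum_(i < n) `|f (t i.+1) - f (t i)| `^ p <=
    \sum_(i < m) `|f (s i.+1) - f (s i)| `^ p].
Proof.
move=> p1; elim: n t => [|n IH] t tP; first by exists 0%N, t.
have [t_alt|] := pselect (alternates f n.+1 t); first by exists n.+1, t.
move=> /existsNP[i /not_implyP[i_n /negP]]; rewrite -leNgt => same_sign.
have {}i_n : (i < n)%N by [].
have [m [s [mn sP s_alt t_le_s]]] := IH _ (subdivision_bump i_n tP).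
exists m, s; split=> //; first exact: ltnW.
by apply: le_trans t_le_s; exact: (sum_incr_bump_le (f := f) (t := t)).
Qed.

Definition reaches (e : R) f g := forall s t : R,
  0 <= s -> s < t -> f s < f t ->
  exists u, [/\ s < u, u <= t & f t <= g u + e].

Lemma exists_reaching_times e f g T n t :
  reaches e f g -> reaches e (\- f) (\- g) -> subdivision 0 T n t ->
  exists v, forall i, (i < n)%N -> [/\ t i < v i, v i <= t i.+1,
    f (t i) < f (t i.+1) -> f (t i.+1) <= g (v i) + e &
    f (t i.+1) < f (t i) -> g (v i) - e <= f (t i.+1)].
Proof.
move=> fg fgN tP; case: (tP) => _ [_ t_lt].
have t_ge0 i : (i < n)%N -> 0 <= t i by move=> /ltnW; exact: subdivision_ge tP.
have /choice[v vP] i : exists v, (i < n)%N -> [/\ t i < v, v <= t i.+1,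
    f (t i) < f (t i.+1) -> f (t i.+1) <= g v + e &
    f (t i.+1) < f (t i) -> g v - e <= f (t i.+1)]; last by exists v.
have [i_n|] := ltnP i n; last by exists 0.
have [up|down|_] := ltgtP (f (t i)) (f (t i.+1)).
- have [u [tu ut fgu]] := fg _ _ (t_ge0 _ i_n) (t_lt _ i_n) up.
  by exists u.
- have [|u [tu ut fgu]] := fgN _ _ (t_ge0 _ i_n) (t_lt _ i_n).
    by rewrite ltrN2.
  by exists u => _; split=> // _; move: fgu => /=; lra.
- by exists (t i.+1) => _; split=> //; exact: t_lt.
Qed.

Lemma alternating_incr_le e f g T n t : 0 <= e ->
  reaches e f g -> reaches e (\- f) (\- g) ->
  subdivision 0 T n t -> alternates f n t ->
  exists u, [/\ subdivision 0 (u n) n u, u n <= T & forall i, (i < n)%N ->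
    `|f (t i.+1) - f (t i)| <= `|g (u i.+1) - g (u i)| +
      (2 * e + (if i == 0%N then `|f 0 - g 0| else 0))].
Proof.
move=> e0 fg fgN tP t_alt; have [t0 [tn t_lt]] := tP.
have [v vP] := exists_reaching_times fg fgN tP.
exists (fun i => if i is j.+1 then v j else 0); split.
- split=> //; split=> // -[|i] i_n /=; first by rewrite -t0; case: (vP 0%N i_n).
  have [_ vt _ _] := vP i (ltnW i_n); have [tv _ _ _] := vP i.+1 i_n.
  exact: le_lt_trans vt tv.
- case: (n) tn vP => [<- _|m tn /(_ m (ltnSn m))[]]; first by rewrite -t0.
  by rewrite -tn.
have norm_bounds (z : R) : - `|z| <= z <= `|z| by rewrite -ler_norml.
move=> [|i] i_n /=.
  have [_ _ f_up f_down] := vP 0%N i_n; rewrite t0 in f_up f_down *.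
  have := norm_bounds (f 0 - g 0); have := norm_bounds (g (v 0%N) - g 0).
  rewrite ler_norml.
  by have [/[dup] /f_up|/[dup] /f_down|->] := ltgtP (f 0) (f (t 1%N)); lra.
have [_ _ f_up f_down] := vP i (ltnW i_n).
have [_ _ f_up' f_down'] := vP i.+1 i_n.
have := norm_bounds (g (v i.+1) - g (v i)); have := t_alt i i_n.
rewrite addr0 ler_norml.
have [up|down|->] := ltgtP (f (t i)) (f (t i.+1)).
- rewrite pmulr_rlt0 ?subr_gt0// subr_lt0 => down'.
  by move: (f_up up) (f_down' down'); lra.
- rewrite nmulr_rlt0 ?subr_lt0// subr_gt0 => up'.
  by move: (f_down down) (f_up' up'); lra.
- by rewrite subrr mul0r ltxx.
Qed.

Lemma real_Vp_le_reaches p f g T : 1 <= p -> 0 <= T ->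
  (forall e : R, 0 < e -> reaches e f g) ->
  (forall e : R, 0 < e -> reaches e (\- f) (\- g)) ->
  (real_Vp p f T <= real_Vp p g T + `|f 0 - g 0|%:E)%E.
Proof.
move=> p1 T0 fg fgN; have p0 : 0 < p by exact: lt_le_trans p1.
apply: Vp_le => // n t tP; rewrite lp_incr_const_mx.
apply/lee_addgt0Pr => eps eps0; pose e := eps / (2 * n.+1%:R).
have e0 : 0 < e by rewrite divr_gt0// mulr_gt0.
have [m [s [mn sP s_alt t_le_s]]] := alternating_subdivision f p1 tP.
have [u [uP uT incr_le]] :=
  alternating_incr_le (ltW e0) (fg e e0) (fgN e e0) sP s_alt.
pose dg (i : 'I_m) := g (u i.+1) - g (u i).
pose error (i : 'I_m) := 2 * e + (if i == 0%N :> nat then `|f 0 - g 0| else 0).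
have lp_error : lp p error <= `|f 0 - g 0| + eps.
  have e2_ge0 : 0 <= 2 * e by rewrite mulr_ge0// ltW.
  apply: le_trans (lp_cst_head_le m p1 e2_ge0 (normr_ge0 _)) _.
  rewrite addrC lerD2l.
  have -> : eps = 2 * e * n.+1%:R by rewrite mulrAC mulrC divfK// mulf_neq0.
  by rewrite ler_wpM2l// ler_nat leqW.
have lp_le :
    lp p (fun i : 'I_n => f (t i.+1) - f (t i)) <= lp p dg + lp p error.
  apply: le_trans (ler_lp_sum (ltW p0) t_le_s) _.
  rewrite -(lp_normr p dg); apply: le_trans (ler_lpD _ _ p1).
  apply: ler_lp => [|i]; first exact: ltW.
  by apply: le_trans (ler_norm _); exact: incr_le.
apply: (@le_trans _ _ (lp p dg + (`|f 0 - g 0| + eps))%:E).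
  by rewrite lee_fin (le_trans lp_le)// lerD2l.
rewrite !EFinD addeA; do 2 apply: leeD => //.
have := lp_incr_le_Vp (fun r : R => const_mx (g r) : 'rV_1) p0 uP uT.
by rewrite lp_incr_const_mx.
Qed.

End alternating_increments.

Lemma cumulative_crossing {R : realType} (F : cumulative R R) (c s t : R) :
  F s < c -> c < F t ->
  exists r, [/\ s < r, r <= t, c <= F r,
    forall u, u < r -> F u <= c & forall v, r < v -> c < F v].
Proof.
move=> Fsc cFt; have ndF := cumulative_is_nondecreasing F.
pose above := [set u | c < F u].
have has_inf_above : has_inf above.
  split; first by exists t.
  exists s => u /= cu; rewrite leNgt; apply/negP => /ltW/ndF/(lt_le_trans cu).
  by rewrite ltNge (ltW Fsc).
pose r := inf above.
have rt : r <= t by apply: ge_inf => //; exact: has_inf_above.2.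
have F_le_c u : u < r -> F u <= c.
  move=> ur; rewrite leNgt; apply/negP => cu.
  by have := ge_inf has_inf_above.2 cu; rewrite leNgt ur.
have c_lt_F v : r < v -> c < F v.
  rewrite -subr_gt0 => /inf_adherent/(_ has_inf_above)[w cw].
  by rewrite subrKC => /ltW/ndF; exact: lt_le_trans.
have cFr : c <= F r.
  apply: (cvgr_to_ge (cumulative_is_right_continuous F r)).
  by near=> v; apply/ltW/c_lt_F; near: v; exact: nbhs_right_gt.
exists r; split=> //.
by rewrite ltNge; apply/negP => /ndF/(le_trans cFr); rewrite leNgt Fsc.
Unshelve. all: by end_near. Qed.

Lemma stieltjes_integral_gt0 {R : realType} (F : cumulative R R) (h : R -> R)
    (D : set R) (c r t : R) :
  r <= t -> `[r, t] `<=` D -> (forall u, D u -> 0 <= h u) ->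
  h @ at_right r --> h r -> 0 < h r ->
  (forall u, u < r -> F u <= c) -> (forall v, r < v -> c < F v) -> c < F t ->
  (0 < \int[lebesgue_stieltjes_measure F]_(u in D) (h u)%:E)%E.
Proof.
move=> rt rtD h0 hr hr_gt0 F_le_c c_lt_F cFt.
have : \forall u \near at_right r, h r / 2 < h u.
  by apply: (cvgr_gt (h r)) => //; rewrite ltr_pdivrMr// ltr_pMr// ltr1n.
move=> [d /= d0 hd]; pose v := Num.min t (r + d / 2).
have rv : r <= v by rewrite /v le_min rt lerDl divr_ge0// ltW.
have vt : v <= t by rewrite /v ge_min lexx.
have vrd : v <= r + d / 2 by rewrite /v ge_min lexx orbT.
have cFv : c < F v.
  rewrite /v; case: (leP t (r + d / 2)) => // _.
  by apply: c_lt_F; rewrite ltrDl divr_gt0.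
have h_ge u : `[r, v] u -> ((h r / 2)%:E <= (h u)%:E)%E.
  rewrite /= in_itv/= lee_fin le_eqVlt => /andP[/predU1P[<-|ru] uv].
    by rewrite ler_pdivrMr// ler_pMr// ler1n.
  apply/ltW/hd => //=; rewrite distrC gtr0_norm ?subr_gt0// ltrBlDl.
  rewrite (le_lt_trans (le_trans uv vrd))// ltrD2l.
  by rewrite ltr_pdivrMr// ltr_pMr// ltr1n.
apply: (@lt_le_trans _ _
    ((h r / 2)%:E * lebesgue_stieltjes_measure F `[r, v])%E).
  rewrite mule_gt0 ?lte_fin ?divr_gt0//.
  apply: lt_le_trans (lebesgue_stieltjes_itvcc_ge rv F_le_c).
  by rewrite lte_fin subr_gt0.
apply: mule_measure_le_integral => //; first by rewrite divr_ge0// ltW.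
by apply: subset_trans rtD; apply: subset_itvl; rewrite bnd_simp.
Qed.

(* The zero is the infimum of [c < F] for a level c between F s and F t: F
   charges every right neighbourhood of that point. *)
Lemma stieltjes_integral0_zero {R : realType} (F : cumulative R R) (h : R -> R)
    (D : set R) (s t e : R) :
  `]s, t] `<=` D -> (forall u, D u -> 0 <= h u) ->
  (forall u, s < u -> u <= t -> h @ at_right u --> h u) ->
  (\int[lebesgue_stieltjes_measure F]_(u in D) (h u)%:E)%E = 0%E ->
  F s < F t -> 0 < e ->
  exists u, [/\ s < u, u <= t, h u = 0 & F t - e <= F u].
Proof.
move=> stD h0 hr int0 Fst e0; pose c := Num.max (F t - e) ((F s + F t) / 2).
have Fsc : F s < c by rewrite /c lt_max; apply/orP; right; lra.
have cFt : c < F t by rewrite /c gt_max; apply/andP; split; lra.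
have [r [sr rt cFr F_le_c c_lt_F]] := cumulative_crossing Fsc cFt.
have rtD : `[r, t] `<=` D.
  by apply: subset_trans stD; apply: subset_itvr; rewrite bnd_simp.
exists r; split=> //; last by rewrite (le_trans _ cFr)// /c le_max lexx.
apply/eqP; rewrite eq_le; apply/andP; split; last first.
  by apply/h0/rtD; rewrite /= in_itv/= lexx rt.
rewrite leNgt; apply/negP => hr_gt0.
have := stieltjes_integral_gt0 rt rtD h0 (hr r sr rt) hr_gt0 F_le_c c_lt_F cFt.
by rewrite int0 ltxx.
Qed.

Section SP_theory.
Context {R : realType} {d : nat}.
Implicit Types l y x k : R -> 'rV[R]_d.

Lemma cadlag_coord x (i : 'I_d) (t : R) : cadlag x -> 0 <= t ->
  (fun s => x s ord0 i) @ at_right t --> x t ord0 i.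
Proof.
move=> [xr _] /xr xt.
apply: (@continuous_cvg _ _ _ _ _ x (fun M : 'rV[R]_d => M ord0 i)) => //.
exact: coord_continuous.
Qed.

Lemma SP_eqD l y x k t : SP l y x k -> 0 <= t -> x t = y t + k t.
Proof. by case=> _ [_] [xyk _] /xyk[]. Qed.

Lemma SP_reflection0 l y x k : SP l y x k -> k 0 = 0.
Proof. by case=> _ [_] [_] []. Qed.

Lemma SP_barrier l y x k j t : SP l y x k -> 0 <= t ->
  (l t - y t) ord0 j <= k t ord0 j.
Proof. by case=> _ [_] [xyk] _ /xyk[-> /(_ j)]; rewrite !mxE lerBlDl. Qed.

Lemma SP_nondecreasing l y x k j s t : SP l y x k -> 0 <= s -> s <= t ->
  k s ord0 j <= k t ord0 j.
Proof. by case=> _ [_] [_] [_] [nd _]; exact: nd. Qed.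

Lemma SP_touch l y x k j (s t e : R) : cadlag l -> SP l y x k ->
  0 <= s -> k s ord0 j < k t ord0 j -> s <= t -> 0 < e ->
  exists u, [/\ s < u, u <= t, k u ord0 j = (l u - y u) ord0 j &
    k t ord0 j - e <= k u ord0 j].
Proof.
move=> cl sp s0 kst st e0; have t0 := le_trans s0 st.
have [cx [_ [xyk [_ [_ /(_ j)[F [Fk [_ int0]]]]]]]] := sp.
pose h u := x u ord0 j - l u ord0 j.
have h_ge0 u : `[0, t]%classic u -> 0 <= h u.
  by rewrite /= in_itv/= => /andP[u0 _]; rewrite subr_ge0; case: (xyk u u0).
have h_rc u : s < u -> u <= t -> h @ at_right u --> h u.
  move=> su _; have u0 : 0 <= u := le_trans s0 (ltW su).
  by apply: cvgB; exact: cadlag_coord.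
have sub : `]s, t] `<=` `[0, t].
  by apply: subset_itvr; rewrite bnd_simp.
have Fst : F s < F t by rewrite !Fk.
have [u [su ut hu Fu]] :=
  stieltjes_integral0_zero sub h_ge0 h_rc (int0 t t0) Fst e0.
have u0 : 0 <= u := le_trans s0 (ltW su).
exists u; split=> //; last by rewrite -!Fk.
by move: hu; rewrite /h (SP_eqD sp u0) !mxE; lra.
Qed.

Variables (l y x k l' y' x' k' : R -> 'rV[R]_d).
Hypotheses (cl : cadlag l) (sp : SP l y x k) (sp' : SP l' y' x' k').

Lemma SP_reaches j (e : R) : 0 < e ->
  reaches e (fun t => (k t - k' t) ord0 j)
    (fun t => ((l t - l' t) - (y t - y' t)) ord0 j).
Proof.
move=> e0 s t s0 st kst.
have k'_nd := SP_nondecreasing j sp' s0 (ltW st).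
have [|u [su ut ku kte]] := SP_touch cl sp s0 _ (ltW st) e0 (j := j).
  by move: kst; rewrite !mxE; lra.
have u0 : 0 <= u := le_trans s0 (ltW su).
exists u; split=> //; move: ku kte.
have := SP_nondecreasing j sp' u0 ut; have := SP_barrier j sp' u0.
by rewrite !mxE; lra.
Qed.

End SP_theory.

Section SP_variation.
Context {R : realType} {d : nat}.
Variables (p T : R) (l y x k l' y' x' k' : R -> 'rV[R]_d).
Hypotheses (p1 : 1 <= p) (T0 : 0 <= T) (cl : cadlag l) (cl' : cadlag l').
Hypotheses (sp : SP l y x k) (sp' : SP l' y' x' k').

Let dl (t : R) : 'rV[R]_d := l t - l' t.
Let dy (t : R) : 'rV[R]_d := y t - y' t.
Let dk (t : R) : 'rV[R]_d := k t - k' t.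
Let dx (t : R) : 'rV[R]_d := x t - x' t.

Let p0 : 0 < p. Proof. exact: lt_le_trans p1. Qed.

Lemma real_Vp_SP_coord_le j :
  (real_Vp p (fun t => dk t ord0 j) T <=
   Vp p dy T + (eucl (dy 0))%:E + Vp p dl T + (eucl (dl 0))%:E)%E.
Proof.
pose g (t : R) : R := (dl t - dy t) ord0 j.
have fg (e : R) : 0 < e -> reaches e (fun t => dk t ord0 j) g.
  by move/(SP_reaches (j := j) cl sp sp').
have fgN (e : R) : 0 < e -> reaches e (\- (fun t => dk t ord0 j)) (\- g).
  move=> e0; have := SP_reaches (j := j) cl' sp' sp e0.
  congr reaches; apply/funext => t.
    by rewrite /dk /= !mxE opprB.
  by rewrite /g /dl /dy /= !mxE; ring.
apply: le_trans (real_Vp_le_reaches p1 T0 fg fgN) _.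
have -> : dk 0 = 0 by rewrite /dk (SP_reflection0 sp) (SP_reflection0 sp') subrr.
rewrite mxE sub0r normrN -addeA addeACA; apply: leeD.
  apply: le_trans (real_Vp_coord_le _ _ p0 T0) _; rewrite addeC.
  by rewrite -(VpN dy p0 T0); exact: (VpD dl (fun t => - dy t)).
rewrite -EFinD lee_fin (le_trans (norm_coord_le_eucl _ j))// addrC.
by rewrite -(euclN (dy 0)) ler_euclD.
Qed.

Lemma Vp_SP_reflection_le :
  (Vp p dk T <= d%:R%:E *
   (Vp p dy T + (eucl (dy 0))%:E + Vp p dl T + (eucl (dl 0))%:E))%E.
Proof.
apply: le_trans (Vp_le_sum_real_Vp _ p1 T0) _.
apply: le_trans (lee_sum _ (fun j _ => real_Vp_SP_coord_le j)) _.
by rewrite sumr_const card_ord mule_natl.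
Qed.

Lemma Vp_SP_solution_le : (Vp p dx T <= Vp p dy T + Vp p dk T)%E.
Proof.
have dxE r : 0 <= r -> dx r = dy r + dk r.
  by move=> r0; rewrite /dx (SP_eqD sp r0) (SP_eqD sp' r0) opprD addrACA.
apply: le_trans (VpD dy dk p1 T0); apply: le_Vp => // s t s0 t0.
by rewrite (dxE s s0) (dxE t t0).
Qed.

End SP_variation.

Theorem theorem2 (R : realType) (d : nat) (p : R)
    (l y l' y' x k x' k' : R -> 'rV[R]_d) :
  1 <= p ->
  cadlag l -> cadlag y -> cadlag l' -> cadlag y' ->
  vle (l 0) (y 0) -> vle (l' 0) (y' 0) ->
  SP l y x k -> SP l' y' x' k' ->
  forall T : R, 0 <= T ->
  (Vp p (fun t => x t - x' t)%R T <=
     (d.+1%:R)%:E * Vp p (fun t => y t - y' t)%R T + (d%:R * eucl (y 0 - y' 0))%:E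
     + d%:R%:E * Vp p (fun t => l t - l' t)%R T + (d%:R * eucl (l 0 - l' 0))%:E)%E /\
  (Vp p (fun t => k t - k' t)%R T <=
     d%:R%:E * Vp p (fun t => y t - y' t)%R T + (d%:R * eucl (y 0 - y' 0))%:E
     + d%:R%:E * Vp p (fun t => l t - l' t)%R T + (d%:R * eucl (l 0 - l' 0))%:E)%E.
Proof.
move=> p1 cl _ cl' _ _ _ sp sp' T T0.
have Vk := Vp_SP_reflection_le p1 T0 cl cl' sp sp'.
have Vx := Vp_SP_solution_le p1 T0 sp sp'.
have Vp_ge0 (z : R -> 'rV[R]_d) : (0 <= Vp p z T)%E by exact: poweR_ge0.
have eucl_ge0E (v : 'rV[R]_d) : (0 <= (eucl v)%:E)%E.
  by rewrite lee_fin eucl_ge0.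
rewrite 3?ge0_muleDr ?adde_ge0// -!EFinM in Vk.
split=> //; apply: le_trans Vx _.
apply: (le_trans (leeD2l _ Vk)).
by rewrite !addeA -natr1 EFinD ge0_muleDl ?mul1e ?lee_fin// (addeC (Vp _ _ _)).
Qed.
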